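(* (1) For every date $D$ and every period $p$, $D+_\downarrow p\le D+_\uparrow p$. (2) For every date $D$ and every period $p$, if $D+_\bot p\neq\bot$ then $D+_\downarrow p = D+_\uparrow p = D+_\bot p$.
   Context: Values (dates). A value is either the error element $\bot$ or a triple $(y,m,d)$ of integers (year, month, day; January is month $1$); triples need not denote an existing day. ''Date'' means such a value. For an integer $y$ and $1\le m\le 12$, $\mathrm{nb\_days}(y,m)$ is the number of days of month $m$ of year $y$ in the Gregorian calendar: 31 for $m\in\{1,3,5,7,8,10,12\}$, 30 for $m\in\{4,6,9,11\}$, and for $m=2$: 29 if $y$ is leap, else 28, where $y$ is leap iff ($4\mid y$ and $100\nmid y$) or $400\mid y$. Expressions: $e ::= v \mid e +_\delta n \mid \mathrm{rnd}_r\,e$ with $v$ a value, $n\in\mathbb Z$, $\delta\in\{y,m,d\}$ ($+_y,+_m,+_d$: addition of years, months, days) and rounding mode $r\in\{\uparrow,\downarrow,\bot\}$. The small-step relation $\to$ is the least relation with the following rules, and $\to^*$ is its reflexive-transitive closure. Error rules: $\bot+_\delta n\to\bot$; $\mathrm{rnd}_r\bot\to\bot$; if $m\notin[1,12]$ then $(y,m,d)+_\delta n\to\bot$ and $\mathrm{rnd}_r(y,m,d)\to\bot$. All following rules assume $1\le m\le 12$. Congruence: if $e\to e'$ then $e+_\delta n\to e'+_\delta n$ and $\mathrm{rnd}_r e\to\mathrm{rnd}_r e'$. Years: $(y,m,d)+_y n\to(y+n,m,d)$. Months: if $1\le m+n\le 12$, $(y,m,d)+_m n\to(y,m+n,d)$;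 if $m+n<1$, $(y,m,d)+_m n\to(y-1,m,d)+_m(n+12)$; if $m+n>12$, $(y,m,d)+_m n\to(y+1,m,d)+_m(n-12)$. Days: write $N=\mathrm{nb\_days}(y,m)$. - If $d<1$ or $d>N$: $(y,m,d)+_d n\to\bot$. - If $1\le d\le N$ and $1\le d+n\le N$: $(y,m,d)+_d n\to(y,m,d+n)$. - If $1\le d\le N$ and $d+n>N$: $(y,m,d)+_d n\to((y,m,1)+_m 1)+_d(n-(N-d)-1)$. - If $1<d\le N$ and $d+n\le 0$: $(y,m,d)+_d n\to(y,m,1)+_d(d-1+n)$. - If $n+1\le 0$ and $(y,m,1)+_m(-1)\to^*(y',m',d')$ (a triple): $(y,m,1)+_d n\to(y',m',1)+_d(n+\mathrm{nb\_days}(y',m'))$. Rounding, with $N=\mathrm{nb\_days}(y,m)$: if $d<1$, $\mathrm{rnd}_r(y,m,d)\to\bot$ for every $r$; if $1\le d\le N$, $\mathrm{rnd}_r(y,m,d)\to(y,m,d)$ for every $r$; if $d>N$: $\mathrm{rnd}_\bot(y,m,d)\to\bot$, $\mathrm{rnd}_\downarrow(y,m,d)\to(y,m,N)$, and $\mathrm{rnd}_\uparrow(y,m,d)\to(y',m',1)$ where $(y,m,d)+_m 1\to^*(y',m',d')$ (a triple). A period $p$ consists of three integers: $n_y$ years, $n_m$ months, $n_d$ days. For an expression $e$ and rounding mode $r$, $e+_r p := \mathrm{rnd}_r\big((e+_y n_y)+_m n_m\big)+_d n_d$. Comparison. Values satisfy $v_1<v_2$ iff both are triples and $v_1$ is strictly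 smaller in the lexicographic order on $(y,m,d)$; $v_1\le v_2$ iff $v_1<v_2$ or $v_1=v_2$. Equality and comparisons between expressions refer to the values they evaluate to (via $\to^*$); $e\ne\bot$ means that $e$ does not evaluate to $\bot$. *)

(* Defs.v *)
From Stdlib Require Import ZArith Relations.
Open Scope Z_scope.

Inductive value : Type :=
| Bot
| YMD (y m d : Z).

Inductive date_unit : Type := Years | Months | Days.

Inductive rounding : Type := RoundUp | RoundDown | RoundBot.

Inductive expr : Type :=
| Val (v : value)
| Add (u : date_unit) (e : expr) (n : Z)
| Rnd (r : rounding) (e : expr).

Definition is_leap (y : Z) : bool :=
  ((y mod 4 =? 0) && negb (y mod 100 =? 0)) || (y mod 400 =? 0).

(* Only meaningful for [1 <= m <= 12]; the default value [0] is never used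
   by the reduction rules. *)
Definition nb_days (y m : Z) : Z :=
  match m with
  | 1 | 3 | 5 | 7 | 8 | 10 | 12 => 31
  | 4 | 6 | 9 | 11 => 30
  | 2 => if is_leap y then 29 else 28
  | _ => 0
  end.

Definition valid_month (m : Z) : Prop := 1 <= m <= 12.

Inductive step : expr -> expr -> Prop :=
| step_add_bot u n :
    step (Add u (Val Bot) n) (Val Bot)
| step_rnd_bot r :
    step (Rnd r (Val Bot)) (Val Bot)
| step_add_invalid_month u y m d n :
    ~ valid_month m ->
    step (Add u (Val (YMD y m d)) n) (Val Bot)
| step_rnd_invalid_month r y m d :
    ~ valid_month m ->
    step (Rnd r (Val (YMD y m d))) (Val Bot)
| step_add_congr u e e' n :
    step e e' ->
    step (Add u e n) (Add u e' n)
| step_rnd_congr r e e' :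
    step e e' ->
    step (Rnd r e) (Rnd r e')
| step_add_years y m d n :
    valid_month m ->
    step (Add Years (Val (YMD y m d)) n) (Val (YMD (y + n) m d))
| step_add_months y m d n :
    valid_month m ->
    1 <= m + n <= 12 ->
    step (Add Months (Val (YMD y m d)) n) (Val (YMD y (m + n) d))
| step_add_months_under y m d n :
    valid_month m ->
    m + n < 1 ->
    step (Add Months (Val (YMD y m d)) n)
         (Add Months (Val (YMD (y - 1) m d)) (n + 12))
| step_add_months_over y m d n :
    valid_month m ->
    m + n > 12 ->
    step (Add Months (Val (YMD y m d)) n)
         (Add Months (Val (YMD (y + 1) m d)) (n - 12))
| step_add_days_invalid_day y m d n :
    valid_month m ->
    d < 1 \/ d > nb_days y m ->
    step (Add Days (Val (YMD y m d)) n) (Val Bot)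
| step_add_days y m d n :
    valid_month m ->
    1 <= d <= nb_days y m ->
    1 <= d + n <= nb_days y m ->
    step (Add Days (Val (YMD y m d)) n) (Val (YMD y m (d + n)))
| step_add_days_over y m d n :
    valid_month m ->
    1 <= d <= nb_days y m ->
    d + n > nb_days y m ->
    step (Add Days (Val (YMD y m d)) n)
         (Add Days (Add Months (Val (YMD y m 1)) 1)
              (n - (nb_days y m - d) - 1))
| step_add_days_under y m d n :
    valid_month m ->
    1 < d <= nb_days y m ->
    d + n <= 0 ->
    step (Add Days (Val (YMD y m d)) n)
         (Add Days (Val (YMD y m 1)) (d - 1 + n))
| step_add_days_under_first y m n y' m' d' :
    valid_month m ->
    n + 1 <= 0 ->
    clos_refl_trans expr step
      (Add Months (Val (YMD y m 1)) (-1)) (Val (YMD y' m' d')) ->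
    step (Add Days (Val (YMD y m 1)) n)
         (Add Days (Val (YMD y' m' 1)) (n + nb_days y' m'))
| step_rnd_day_under r y m d :
    valid_month m ->
    d < 1 ->
    step (Rnd r (Val (YMD y m d))) (Val Bot)
| step_rnd_day_valid r y m d :
    valid_month m ->
    1 <= d <= nb_days y m ->
    step (Rnd r (Val (YMD y m d))) (Val (YMD y m d))
| step_rnd_bot_over y m d :
    valid_month m ->
    d > nb_days y m ->
    step (Rnd RoundBot (Val (YMD y m d))) (Val Bot)
| step_rnd_down y m d :
    valid_month m ->
    d > nb_days y m ->
    step (Rnd RoundDown (Val (YMD y m d))) (Val (YMD y m (nb_days y m)))
| step_rnd_up y m d y' m' d' :
    valid_month m ->
    d > nb_days y m ->
    clos_refl_trans expr step
      (Add Months (Val (YMD y m d)) 1) (Val (YMD y' m' d')) ->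
    step (Rnd RoundUp (Val (YMD y m d))) (Val (YMD y' m' 1)).

Definition steps : expr -> expr -> Prop := clos_refl_trans expr step.

Definition evaluates_to (e : expr) (v : value) : Prop := steps e (Val v).

Record period : Type :=
  Period { p_years : Z; p_months : Z; p_days : Z }.

Definition add_period (r : rounding) (e : expr) (p : period) : expr :=
  Add Days (Rnd r (Add Months (Add Years e (p_years p)) (p_months p)))
      (p_days p).

Definition value_lt (v1 v2 : value) : Prop :=
  match v1, v2 with
  | YMD y1 m1 d1, YMD y2 m2 d2 =>
      y1 < y2 \/ (y1 = y2 /\ (m1 < m2 \/ (m1 = m2 /\ d1 < d2)))
  | _, _ => False
  end.

Definition value_le (v1 v2 : value) : Prop := value_lt v1 v2 \/ v1 = v2.

(* A relation on values lifted to expressions; it requires both sides to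
   evaluate to a value. *)
Definition expr_rel (R : value -> value -> Prop) (e1 e2 : expr) : Prop :=
  exists v1 v2, evaluates_to e1 v1 /\ evaluates_to e2 v2 /\ R v1 v2.

Definition expr_le : expr -> expr -> Prop := expr_rel value_le.

Definition expr_eq : expr -> expr -> Prop := expr_rel eq.

Definition not_bot (e : expr) : Prop := ~ evaluates_to e Bot.

(* Main.v *)
(** Number the days consecutively by [day_number].  This numbering is strictly
    monotone on existing days for the lexicographic order, and adding [n] days
    to an existing day evaluates to an existing day whose number is larger by
    [n].  The two roundings differ only when the intermediate day exceeds the
    length [N] of its month; then rounding down gives the [N]-th of that month
    and rounding up the following day, so after adding [n_d] days to both, the
    numbers still differ by exactly one. *)
Require Import Defs.
From Stdlib Require Import ZArith Relations Lia.
Open Scope Z_scope.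

(** * Consecutive numbering of the days of the Gregorian calendar *)

(** For [y >= 0], the number of leap years among 1, ..., [y]; floor division extends it to negative
    years. *)
Definition leap_days (y : Z) : Z := y / 4 - y / 100 + y / 400.

Definition days_before_month (y m : Z) : Z :=
  let l := if is_leap y then 1 else 0 in
  match m with
  | 1 => 0 | 2 => 31 | 3 => 59 + l | 4 => 90 + l | 5 => 120 + l | 6 => 151 + l
  | 7 => 181 + l | 8 => 212 + l | 9 => 243 + l | 10 => 273 + l | 11 => 304 + l
  | 12 => 334 + l | _ => 0
  end.

(** The number of the day just before the month. The leap day of [y] itself is counted by
    [days_before_month], hence [leap_days (y - 1)]. The origin is arbitrary, as only differences and
    order matter. *)
Definition month_start (y m : Z) : Z :=
  365 * y + leap_days (y - 1) + days_before_month y m.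

Definition day_number (y m d : Z) : Z := month_start y m + d.

Definition valid_date (y m d : Z) : Prop :=
  valid_month m /\ 1 <= d <= nb_days y m.

Lemma valid_month_cases m :
  valid_month m ->
  m = 1 \/ m = 2 \/ m = 3 \/ m = 4 \/ m = 5 \/ m = 6 \/
  m = 7 \/ m = 8 \/ m = 9 \/ m = 10 \/ m = 11 \/ m = 12.
Proof. unfold valid_month; lia. Qed.

Ltac case_month H :=
  let K := fresh in
  pose proof (valid_month_cases _ H) as K;
  repeat (destruct K as [K | K]); subst.

Lemma nb_days_bounds y m : valid_month m -> 28 <= nb_days y m <= 31.
Proof. intros H; case_month H; simpl; try destruct (is_leap y); lia. Qed.

(** From [y - 1] to [y], the quotient by 4, 100 or 400 grows by one exactly when that divisor
    divides [y]; the signs combine these increments into the leap year rule. *)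
Lemma leap_days_pred y :
  leap_days y = leap_days (y - 1) + if is_leap y then 1 else 0.
Proof.
unfold leap_days, is_leap.
destruct (Z.eqb_spec (y mod 4) 0), (Z.eqb_spec (y mod 100) 0),
  (Z.eqb_spec (y mod 400) 0); simpl; Z.div_mod_to_equations; lia.
Qed.

Lemma month_start_next_month y m :
  valid_month m -> m < 12 ->
  month_start y (m + 1) = month_start y m + nb_days y m.
Proof.
unfold month_start; intros H Hm.
(* The year part is common to both sides; abstracting it leaves only the table of months. *)
generalize (365 * y + leap_days (y - 1)); intros s.
case_month H; simpl; try destruct (is_leap y); lia.
Qed.

Lemma month_start_next_year y :
  month_start (y + 1) 1 = month_start y 12 + nb_days y 12.
Proof.
unfold month_start; replace (y + 1 - 1) with y by lia.
rewrite (leap_days_pred y); unfold days_before_month, nb_days.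
destruct (is_leap y); lia.
Qed.

Lemma month_start_mono_month y m1 m2 :
  valid_month m1 -> valid_month m2 -> m1 < m2 ->
  month_start y m1 + nb_days y m1 <= month_start y m2.
Proof.
unfold month_start; intros H1 H2 Hlt.
generalize (365 * y + leap_days (y - 1)); intros s.
case_month H1; case_month H2; try lia; simpl; destruct (is_leap y); lia.
Qed.

Lemma month_start_mono_year y1 y2 :
  y1 < y2 -> month_start y1 12 + nb_days y1 12 <= month_start y2 1.
Proof.
intros Hlt; rewrite <- month_start_next_year.
unfold month_start, leap_days, days_before_month; Z.div_mod_to_equations; lia.
Qed.

(** For distinct years, the comparison passes through December of [y1] and January of [y2]. *)
Lemma month_start_mono y1 m1 y2 m2 :
  valid_month m1 -> valid_month m2 ->
  y1 < y2 \/ (y1 = y2 /\ m1 < m2) ->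
  month_start y1 m1 + nb_days y1 m1 <= month_start y2 m2.
Proof.
intros H1 H2 [Hy | [<- Hm]]; [ | now apply month_start_mono_month].
assert (V1 : valid_month 1) by (unfold valid_month; lia).
assert (V12 : valid_month 12) by (unfold valid_month; lia).
pose proof (month_start_mono_year _ _ Hy).
pose proof (nb_days_bounds y1 12 V12).
pose proof (nb_days_bounds y2 1 V1).
assert (month_start y1 m1 + nb_days y1 m1 <= month_start y1 12 + nb_days y1 12).
{ destruct (Z.eq_dec m1 12) as [-> | ]; [lia | ].
  enough (month_start y1 m1 + nb_days y1 m1 <= month_start y1 12) by lia.
  apply month_start_mono_month; auto; unfold valid_month in *; lia. }
assert (month_start y2 1 <= month_start y2 m2).
{ destruct (Z.eq_dec m2 1) as [-> | ]; [lia | ].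
  enough (month_start y2 1 + nb_days y2 1 <= month_start y2 m2) by lia.
  apply month_start_mono_month; auto; unfold valid_month in *; lia. }
lia.
Qed.

(** If the second month came strictly earlier, [month_start_mono] would put its whole range of
    numbers before the first date. *)
Lemma day_number_lt_lex y1 m1 d1 y2 m2 d2 :
  valid_date y1 m1 d1 -> valid_date y2 m2 d2 ->
  day_number y1 m1 d1 < day_number y2 m2 d2 ->
  value_lt (YMD y1 m1 d1) (YMD y2 m2 d2).
Proof.
unfold day_number; intros [V1 D1] [V2 D2] Hlt; simpl.
assert (C : (y2 < y1 \/ (y2 = y1 /\ m2 < m1)) \/
            (y1 = y2 /\ m1 = m2) \/
            y1 < y2 \/ (y1 = y2 /\ m1 < m2)) by lia.
destruct C as [C | [[-> ->] | C]]; [ | lia | lia].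
pose proof (month_start_mono y2 m2 y1 m1 V2 V1 C); lia.
Qed.

(** * Reduction sequences and addition of months *)

Lemma steps_step e1 e2 e3 : step e1 e2 -> steps e2 e3 -> steps e1 e3.
Proof. intros H12 H23; eapply rt_trans; [apply rt_step | ]; eassumption. Qed.

Lemma steps_add u e e' n : steps e e' -> steps (Add u e n) (Add u e' n).
Proof.
induction 1 as [? ? H | | ].
- now apply rt_step, step_add_congr.
- apply rt_refl.
- eapply rt_trans; eassumption.
Qed.

Lemma steps_rnd r e e' : steps e e' -> steps (Rnd r e) (Rnd r e').
Proof.
induction 1 as [? ? H | | ].
- now apply rt_step, step_rnd_congr.
- apply rt_refl.
- eapply rt_trans; eassumption.
Qed.

Lemma add_months_evaluates y m d n :
  valid_month m ->
  exists y' m', valid_month m' /\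
    steps (Add Months (Val (YMD y m d)) n) (Val (YMD y' m' d)).
Proof.
intros Hm.
(* [k] bounds the number of year changes: each moves [m + n] by 12 towards the range 1 to 12, which
   is the interval for [k = 0]. *)
assert (Hk : exists k : nat, -12 * Z.of_nat k < m + n <= 12 * (Z.of_nat k + 1))
  by (exists (Z.to_nat (1 + Z.abs (m + n))); lia).
destruct Hk as [k Hk]; revert y n Hk; induction k as [ | k IH]; intros y n Hk.
- exists y, (m + n); split; [unfold valid_month; lia | ].
  apply rt_step, step_add_months; [assumption | lia].
- destruct (Z_lt_ge_dec (m + n) 1) as [Hlt | Hge].
  + destruct (IH (y - 1) (n + 12)) as (y' & m' & V & S); [lia | ].
    exists y', m'; split; [assumption | ].
    eapply steps_step; [now apply step_add_months_under | exact S].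
  + destruct (Z_le_gt_dec (m + n) 12) as [Hle | Hgt].
    * exists y, (m + n); split; [unfold valid_month; lia | ].
      apply rt_step, step_add_months; [assumption | lia].
    * destruct (IH (y + 1) (n - 12)) as (y' & m' & V & S); [lia | ].
      exists y', m'; split; [assumption | ].
      eapply steps_step; [now apply step_add_months_over | exact S].
Qed.

(** The day [d] is arbitrary because rounding up takes this step from a day beyond the end of the
    month. *)
Lemma next_month_evaluates y m d :
  valid_month m ->
  exists y' m', valid_month m' /\
    month_start y' m' = month_start y m + nb_days y m /\
    steps (Add Months (Val (YMD y m d)) 1) (Val (YMD y' m' d)).
Proof.
intros Hm; destruct (Z.eq_dec m 12) as [-> | Hne].
- exists (y + 1), 1; split; [unfold valid_month; lia | ].
  split; [apply month_start_next_year | ].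
  eapply steps_step; [apply step_add_months_over; [assumption | lia] | ].
  apply rt_step, (step_add_months (y + 1) 12 d (1 - 12)); [assumption | lia].
- unfold valid_month in Hm; exists y, (m + 1).
  split; [unfold valid_month; lia | ].
  split; [apply month_start_next_month; unfold valid_month; lia | ].
  apply rt_step, step_add_months; [assumption | lia].
Qed.

Lemma prev_month_evaluates y m d :
  valid_month m ->
  exists y' m', valid_month m' /\
    month_start y m = month_start y' m' + nb_days y' m' /\
    steps (Add Months (Val (YMD y m d)) (-1)) (Val (YMD y' m' d)).
Proof.
intros Hm; destruct (Z.eq_dec m 1) as [-> | Hne].
- exists (y - 1), 12; split; [unfold valid_month; lia | ].
  split.
  { rewrite <- month_start_next_year; f_equal; lia. }
  eapply steps_step; [apply step_add_months_under; [assumption | lia] | ].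
  apply rt_step, (step_add_months (y - 1) 1 d (-1 + 12)); [assumption | lia].
- unfold valid_month in Hm; exists y, (m + -1).
  split; [unfold valid_month; lia | ].
  split.
  { rewrite <- month_start_next_month by (unfold valid_month; lia); f_equal; lia. }
  apply rt_step, step_add_months; [assumption | lia].
Qed.

(** * Addition of days *)

Definition days_evaluate (y m d n : Z) : Prop :=
  exists y' m' d', valid_date y' m' d' /\
    day_number y' m' d' = day_number y m d + n /\
    steps (Add Days (Val (YMD y m d)) n) (Val (YMD y' m' d')).

Lemma days_evaluate_within y m d n :
  valid_date y m d -> 1 <= d + n <= nb_days y m -> days_evaluate y m d n.
Proof.
intros [Hm Hd] Hn; exists y, m, (d + n); split; [now split | ].
split; [unfold day_number; lia | ].
now apply rt_step, step_add_days.
Qed.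

(** The continuation from the first of a month is a hypothesis, so that the lemma serves both inside
    the induction of [days_evaluate_first] and after it. *)
Lemma days_evaluate_over y m d n :
  valid_date y m d -> d + n > nb_days y m ->
  (forall y' m', valid_month m' ->
     days_evaluate y' m' 1 (n - (nb_days y m - d) - 1)) ->
  days_evaluate y m d n.
Proof.
intros [Hm Hd] Hn IH.
destruct (next_month_evaluates y m 1 Hm) as (y1 & m1 & V1 & E1 & S1).
destruct (IH y1 m1 V1) as (y' & m' & d' & V & E & S).
exists y', m', d'; split; [assumption | ].
split; [unfold day_number in *; lia | ].
eapply steps_step; [now apply step_add_days_over | ].
eapply rt_trans; [apply steps_add, S1 | exact S].
Qed.

(* Going backwards may turn a small negative [n] into a positive one, up to 30;
   the offset 31 makes the measure decrease in that step too. *)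
Lemma days_evaluate_first y m n : valid_month m -> days_evaluate y m 1 n.
Proof.
intros Hm.
assert (Hk : exists k : nat,
          0 <= n < Z.of_nat k \/ (n < 0 /\ 31 - n < Z.of_nat k))
  by (exists (Z.to_nat (32 + Z.abs n)); lia).
destruct Hk as [k Hk]; revert y m n Hm Hk.
induction k as [ | k IH]; intros y m n Hm Hk; [lia | ].
pose proof (nb_days_bounds y m Hm).
destruct (Z_lt_ge_dec n 0) as [Hneg | Hpos].
- destruct (prev_month_evaluates y m 1 Hm) as (y1 & m1 & V1 & E1 & S1).
  pose proof (nb_days_bounds y1 m1 V1).
  destruct (IH y1 m1 (n + nb_days y1 m1) V1) as (y' & m' & d' & V & E & S);
    [lia | ].
  exists y', m', d'; split; [assumption | ].
  split; [unfold day_number in *; lia | ].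
  eapply steps_step; [ | exact S].
  eapply step_add_days_under_first; [assumption | lia | exact S1].
- assert (V : valid_date y m 1) by (split; [assumption | lia]).
  destruct (Z_lt_ge_dec n (nb_days y m)) as [Hlt | Hge].
  + apply days_evaluate_within; [assumption | lia].
  + apply days_evaluate_over; [assumption | lia | ].
    intros y' m' V'; apply IH; [assumption | lia].
Qed.

(** Unless the sum stays in the month, reduction first reaches the first of this month or of the
    next one, where [days_evaluate_first] applies. *)
Lemma days_evaluate_valid y m d n : valid_date y m d -> days_evaluate y m d n.
Proof.
intros V; pose proof V as [Hm Hd].
destruct (Z_le_gt_dec (d + n) 0) as [Hle | Hgt].
- destruct (Z.eq_dec d 1) as [-> | Hne]; [now apply days_evaluate_first | ].
  destruct (days_evaluate_first y m (d - 1 + n) Hm)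
    as (y' & m' & d' & V' & E & S).
  exists y', m', d'; split; [assumption | ].
  split; [unfold day_number in *; lia | ].
  eapply steps_step; [apply step_add_days_under; [assumption | lia | lia] | exact S].
- destruct (Z_le_gt_dec (d + n) (nb_days y m)) as [Hin | Hover].
  + apply days_evaluate_within; [assumption | lia].
  + apply days_evaluate_over; [assumption | assumption | ].
    intros; now apply days_evaluate_first.
Qed.

(** * Addition of a period under the three roundings *)

Lemma add_period_evaluates_bot r e p :
  evaluates_to (Rnd r (Add Months (Add Years e (p_years p)) (p_months p))) Bot ->
  evaluates_to (add_period r e p) Bot.
Proof.
intros H; eapply rt_trans; [apply steps_add, H | ].
apply rt_step, step_add_bot.
Qed.

Lemma rnd_months_bot r e n :
  steps e (Val Bot) ->
  steps (Rnd r (Add Months e n)) (Val Bot).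
Proof.
intros H; eapply rt_trans; [apply steps_rnd, steps_add, H | ].
eapply steps_step; [apply step_rnd_congr, step_add_bot | ].
apply rt_step, step_rnd_bot.
Qed.

(** One case split serves both halves of the theorem: an error common to all modes, an existing
    intermediate day that no mode changes, or a day past the end of its month. *)
Lemma add_period_cases D p :
  (forall r, evaluates_to (add_period r (Val D) p) Bot) \/
  (exists v, forall r, evaluates_to (add_period r (Val D) p) v) \/
  (evaluates_to (add_period RoundBot (Val D) p) Bot /\
   exists v w, evaluates_to (add_period RoundDown (Val D) p) v /\
     evaluates_to (add_period RoundUp (Val D) p) w /\ value_lt v w).
Proof.
destruct D as [ | y0 m0 d].
{ left; intros r; apply add_period_evaluates_bot, rnd_months_bot.
  apply rt_step, step_add_bot. }
assert (Dec : valid_month m0 \/ ~ valid_month m0) by (unfold valid_month; lia).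
destruct Dec as [Hm0 | Hm0]; cycle 1.
{ left; intros r; apply add_period_evaluates_bot, rnd_months_bot.
  now apply rt_step, step_add_invalid_month. }
destruct (add_months_evaluates (y0 + p_years p) m0 d (p_months p) Hm0)
  as (y & m & Hm & S).
assert (R : forall r, steps
   (Rnd r (Add Months (Add Years (Val (YMD y0 m0 d)) (p_years p)) (p_months p)))
   (Rnd r (Val (YMD y m d)))).
{ intros r; apply steps_rnd; eapply rt_trans; [ | exact S].
  now apply steps_add, rt_step, step_add_years. }
(* By [R] the modes share the year and month additions, so each evaluation amounts to one rounding
   step and one addition of days. *)
assert (A : forall r v w, step (Rnd r (Val (YMD y m d))) (Val v) ->
   steps (Add Days (Val v) (p_days p)) (Val w) ->
   evaluates_to (add_period r (Val (YMD y0 m0 d)) p) w).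
{ intros r v w Hr Hw; eapply rt_trans; [ | exact Hw].
  apply steps_add; eapply rt_trans; [apply R | now apply rt_step]. }
pose proof (nb_days_bounds y m Hm) as Hnb.
destruct (Z_lt_ge_dec d 1) as [Hd | Hd].
{ left; intros r; eapply A; [now apply step_rnd_day_under | ].
  apply rt_step, step_add_bot. }
destruct (Z_le_gt_dec d (nb_days y m)) as [HdN | HdN].
- right; left.
  destruct (days_evaluate_valid y m d (p_days p)) as (y' & m' & d' & _ & _ & S');
    [split; [assumption | lia] | ].
  exists (YMD y' m' d'); intros r; eapply A; [ | exact S'].
  apply step_rnd_day_valid; [assumption | lia].
- right; right; split.
  { eapply A; [now apply step_rnd_bot_over | apply rt_step, step_add_bot]. }
  destruct (next_month_evaluates y m d Hm) as (yn & mn & Vn & En & Sn).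
  pose proof (nb_days_bounds yn mn Vn).
  destruct (days_evaluate_valid y m (nb_days y m) (p_days p))
    as (y1 & m1 & d1 & V1 & E1 & S1); [split; [assumption | lia] | ].
  destruct (days_evaluate_valid yn mn 1 (p_days p))
    as (y2 & m2 & d2 & V2 & E2 & S2); [split; [assumption | lia] | ].
  exists (YMD y1 m1 d1), (YMD y2 m2 d2); repeat split.
  + eapply A; [now apply step_rnd_down | exact S1].
  + eapply A; [eapply step_rnd_up; eassumption | exact S2].
  + apply day_number_lt_lex; [assumption | assumption | ].
    (* By [En], the first of the next month is numbered one more than the last of this month, and
       both numbers are shifted by [p_days p]. *)
    rewrite E1, E2; unfold day_number; lia.
Qed.

Theorem theorem4 :
  (forall (D : value) (p : period),
     expr_le (add_period RoundDown (Val D) p) (add_period RoundUp (Val D) p))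
  /\
  (forall (D : value) (p : period),
     not_bot (add_period RoundBot (Val D) p) ->
     expr_eq (add_period RoundDown (Val D) p) (add_period RoundUp (Val D) p) /\
     expr_eq (add_period RoundUp (Val D) p) (add_period RoundBot (Val D) p)).
Proof.
split; intros D p.
- destruct (add_period_cases D p) as [H | [[v H] | [_ (v & w & Hv & Hw & Hlt)]]].
  + exists Bot, Bot; repeat split; [apply H | apply H | now right].
  + exists v, v; repeat split; [apply H | apply H | now right].
  + exists v, w; repeat split; [assumption | assumption | now left].
- intros Hnb.
  (* Only the middle case survives: in the other two, [RoundBot] gives [Bot]. *)
  destruct (add_period_cases D p) as [H | [[v H] | [H _]]].
  + now destruct (Hnb (H RoundBot)).
  + split; exists v, v; repeat split; apply H.
  + now destruct (Hnb H).
Qed.
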